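(* Let $\mathcal{H}=\mathcal{H}_1\oplus\mathcal{H}_2\oplus\mathcal{H}_3$ (orthogonal direct sum), $q\in\mathcal{D}$, and $$T=\begin{pmatrix}0&S_1&0\\0&0&S_2\\0&0&0\end{pmatrix}\in\mathcal{B}(\mathcal{H}),$$ with bounded linear operators $S_1:\mathcal{H}_2\to\mathcal{H}_1$ and $S_2:\mathcal{H}_3\to\mathcal{H}_2$. Then $$w_q(T)\le\begin{cases}\sqrt{2}\,\max\{\|S_1\|,\|S_2\|\}, & \text{if } |q|\in\left[0,\frac{1}{\sqrt2}\right],\\[4pt] \left(\dfrac{\sqrt2+|q|+\sqrt{1-|q|^2}}{2}\right)\max\{\|S_1\|,\|S_2\|\}, & \text{if } |q|\in\left(\frac{1}{\sqrt2},1\right].\end{cases}$$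
   Context: $\mathcal{H}$ is a separable infinite-dimensional complex Hilbert space with inner product $\langle\cdot,\cdot\rangle$; $\mathcal{B}(\mathcal{H})$ is the algebra of bounded linear operators on $\mathcal{H}$; $\mathcal{D}=\{z\in\mathbb{C}:|z|\le1\}$. The $q$-numerical range is $W_q(T)=\{\langle Tx,y\rangle: x,y\in\mathcal{H},\ \|x\|=\|y\|=1,\ \langle x,y\rangle=q\}$ and the $q$-numerical radius is $w_q(T)=\sup\{|\lambda|:\lambda\in W_q(T)\}$. *)

(* Defs.v *)
From HB Require Import structures.
From mathcomp Require Import all_boot all_order all_algebra sesquilinear.
From mathcomp Require Import all_classical all_reals all_analysis.
From mathcomp Require Import complex.
From mathcomp Require Import ring.

Set Implicit Arguments.
Unset Strict Implicit.
Unset Printing Implicit Defensive.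

Import Order.TTheory GRing.Theory Num.Theory numFieldNormedType.Exports.
Import Normc.

Local Open Scope classical_set_scope.
Local Open Scope ring_scope.
Local Open Scope complex_scope.

(* The norm of a space over R[i] takes its values in (the nonnegative reals of)
   R[i]; [hdot] is linear in its first argument, conjugate-linear in the
   second. *)
HB.mixin Record isHilbert (R : realType) H & CompleteNormedModule R[i] H := {
  hdot : {dot H for (@Num.conj R[i])} ;
  hdot_norm : forall x : H, hdot x x = `|x| ^+ 2
}.

#[short(type="hilbertType")]
HB.structure Definition Hilbert (R : realType) :=
  {H of CompleteNormedModule R[i] H & isHilbert R H}.

Definition separable (T : topologicalType) :=
  exists A : set T, countable A /\ dense A.

Definition infinite_dim (K : fieldType) (V : lmodType K) :=
  forall (n : nat) (e : 'I_n -> V),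
    ~ (forall x : V, exists c : 'I_n -> K, x = \sum_i c i *: e i).

(* The orthogonal direct sum. This is an alias because the product type itself
   already carries the max norm as a normed module; here
   |(x1, x2)|^2 = |x1|^2 + |x2|^2. *)
Definition hsum (R : realType) (H1 H2 : hilbertType R) : Type :=
  (H1 * H2)%type.

Notation "H1 \oplus H2" := (hsum H1 H2) (at level 50, left associativity)
  : type_scope.

Section hsum.
Context {R : realType} (H1 H2 : hilbertType R).
Local Notation H := (hsum H1 H2).

HB.instance Definition _ := GRing.Lmodule.copy H (H1 * H2)%type.

Definition hsum_dot (x y : H) : R[i] := hdot x.1 y.1 + hdot x.2 y.2.

Let hsum_dot_bilinear : bilinear_for
  (GRing.Scale.Law.clone _ _ ( *%R : R[i] -> R[i] -> R[i]) _)
  (GRing.Scale.Law.clone _ _ ((@Num.conj R[i]) \; *%R) _)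
  (hsum_dot : H -> H -> R[i]).
Proof.
split=> u a x y; rewrite /hsum_dot /=.
  by rewrite !linearPl /=; ring.
by rewrite !linearPr /=; ring.
Qed.

HB.instance Definition _ := bilinear_isBilinear.Build R[i] H H R[i] _ _
  hsum_dot hsum_dot_bilinear.

Let hsum_dot_herm (x y : H) :
  hsum_dot x y = (-1) ^+ false * (hsum_dot y x)^*%R.
Proof.
rewrite /hsum_dot rmorphD /= expr0 mul1r (hermC _ x.1) (hermC _ x.2) /=.
by rewrite !expr0 !mul1r.
Qed.

HB.instance Definition _ := isHermitianSesquilinear.Build R[i] H false
  (@Num.conj R[i]) hsum_dot hsum_dot_herm.

Let hsum_dot_gt0 (x : H) : x != 0 -> 0 < hsum_dot x x.
Proof.
move=> xN0; rewrite lt_def /hsum_dot !hdot_norm addr_ge0 ?exprn_ge0// andbT.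
rewrite paddr_eq0 ?exprn_ge0// !expf_eq0 /= !normr_eq0.
by apply: contra xN0; case: x => a b /= /andP[/eqP-> /eqP->].
Qed.

HB.instance Definition _ := isDotProduct.Build R[i] H hsum_dot hsum_dot_gt0.

Definition hsum_norm (x : H) : R[i] := sqrtC (hsum_dot x x).

Let hsum_normD x y : hsum_norm (x + y) <= hsum_norm x + hsum_norm y.
Proof.
have ge0 z : 0 <= hsum_norm z by exact: sqrt_dnorm_ge0.
rewrite -(@ler_pXn2r _ 2) ?nnegrE ?addr_ge0// sqrrD !sqrtCK.
rewrite /hsum_dot !hdot_norm /=.
set a := `|x.1|; set b := `|x.2|; set c := `|y.1|; set d := `|y.2|.
have ac : `|x.1 + y.1| ^+ 2 <= (a + c) ^+ 2.
  by rewrite ler_pXn2r ?nnegrE ?addr_ge0 ?normr_ge0// ler_normD.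
have bd : `|x.2 + y.2| ^+ 2 <= (b + d) ^+ 2.
  by rewrite ler_pXn2r ?nnegrE ?addr_ge0 ?normr_ge0// ler_normD.
apply: (le_trans (lerD ac bd)).
have -> : (a + c) ^+ 2 + (b + d) ^+ 2 =
    a ^+ 2 + b ^+ 2 + (a * c + b * d) *+ 2 + (c ^+ 2 + d ^+ 2) by ring.
rewrite lerD2r lerD2l ler_wMn2r//.
rewrite -(@ler_pXn2r _ 2) ?nnegrE ?addr_ge0 ?mulr_ge0 ?normr_ge0//.
rewrite exprMn !sqrtCK /hsum_dot !hdot_norm -subr_ge0.
have -> : (a ^+ 2 + b ^+ 2) * (c ^+ 2 + d ^+ 2) - (a * c + b * d) ^+ 2 =
    (a * d - b * c) ^+ 2 by ring.
by rewrite real_exprn_even_ge0// rpredB// rpredM// normr_real.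
Qed.

Let hsum_normZ (l : R[i]) x : hsum_norm (l *: x) = `|l| * hsum_norm x.
Proof.
by rewrite /hsum_norm dnormZ rootCMl ?exprn_ge0// exprCK.
Qed.

Let hsum_norm_eq0 x : hsum_norm x = 0 -> x = 0.
Proof. by move=> /eqP; rewrite sqrt_dnorm_eq0 => /eqP. Qed.

HB.instance Definition _ := Lmodule_isNormed.Build R[i] H
  hsum_normD hsum_normZ hsum_norm_eq0.

Lemma hsum_normE (x : H) : `|x| ^+ 2 = `|x.1| ^+ 2 + `|x.2| ^+ 2.
Proof. by rewrite sqrtCK /hsum_dot !hdot_norm. Qed.

Lemma hsum_norm_fst (x : H) : `|x.1| <= `|x|.
Proof.
rewrite -(@ler_pXn2r _ 2) ?nnegrE// hsum_normE.
by rewrite lerDl exprn_ge0.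
Qed.

Lemma hsum_norm_snd (x : H) : `|x.2| <= `|x|.
Proof.
rewrite -(@ler_pXn2r _ 2) ?nnegrE// hsum_normE.
by rewrite lerDr exprn_ge0.
Qed.

Lemma hsum_norm_le (x : H) : `|x| <= `|x.1| + `|x.2|.
Proof.
rewrite -(@ler_pXn2r _ 2) ?nnegrE ?addr_ge0// hsum_normE sqrrD.
by rewrite lerD2r lerDl mulrn_wge0// mulr_ge0.
Qed.

Let hsum_complete (F : set_system H) : ProperFilter F -> cauchy F -> cvg F.
Proof.
move=> FF /cauchy_ballP Fc.
have /cauchy_cvg/cvg_ex[l1 Fl1] : cauchy (fst @ F).
  apply/cauchy_ballP => e e0; near_simpl; have := Fc e e0.
  apply: filterS => -[x y]; rewrite -!ball_normE /=.
  exact/le_lt_trans/(hsum_norm_fst (x - y)).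
have /cauchy_cvg/cvg_ex[l2 Fl2] : cauchy (snd @ F).
  apply/cauchy_ballP => e e0; near_simpl; have := Fc e e0.
  apply: filterS => -[x y]; rewrite -!ball_normE /=.
  exact/le_lt_trans/(hsum_norm_snd (x - y)).
apply/cvg_ex; exists ((l1, l2) : H).
apply/cvgrPdist_lt => e e0; near=> z.
apply: (le_lt_trans (hsum_norm_le _)); rewrite (splitr e) ltrD//=.
  near: z; move/cvgrPdist_lt: Fl1; apply; exact: divr_gt0.
near: z; move/cvgrPdist_lt: Fl2; apply; exact: divr_gt0.
Unshelve. all: by end_near. Qed.

HB.instance Definition _ := Uniform_isComplete.Build H hsum_complete.

HB.instance Definition _ := isHilbert.Build R H
  (hdot := hsum_dot) (fun x => esym (sqrtCK _)).
End hsum.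

(* [M] ranges over R[i], where an inequality forces the difference of its sides
   to be real; so [M] is a nonnegative real as soon as [H] is nontrivial. *)
HB.mixin Record isBoundedOp (R : realType) (H K : hilbertType R) (f : H -> K) :=
  { bounded_op : exists M : R[i], forall x : H, `|f x| <= M * `|x| }.

HB.structure Definition BoundedOp (R : realType) (H K : hilbertType R) :=
  {f of @GRing.Linear R[i] H K *:%R f & isBoundedOp R H K f}.

Notation "{ 'bounded' H -> K }" := (@BoundedOp.type _ H%type K%type)
  (at level 0, H at level 98, K at level 99, format "{ 'bounded'  H  ->  K }")
  : type_scope.

Section bounded_op.
Context {R : realType}.
Implicit Types H K : hilbertType R.

Lemma bounded_op_ge0 H K (f : {bounded H -> K}) :
  exists2 M : R[i], 0 <= M & forall x : H, `|f x| <= M * `|x|.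
Proof.
have [M fM] := @bounded_op _ _ _ f; exists `|M| => // x.
have le0 := le_trans (normr_ge0 (f x)) (fM x).
by rewrite (le_trans (fM x))// -(ger0_norm le0) normrM normr_id.
Qed.

Definition op0 H K : H -> K := fun=> 0.
Arguments op0 : clear implicits.

Let op0_linear H K : linear (op0 H K).
Proof. by move=> a x y; rewrite /op0 scaler0 addr0. Qed.

HB.instance Definition _ H K :=
  GRing.isLinear.Build R[i] H K *:%R (op0 H K) (@op0_linear H K).

Let op0_bounded H K : exists M : R[i], forall x : H, `|op0 H K x| <= M * `|x|.
Proof. by exists 0 => x; rewrite normr0 mul0r. Qed.

HB.instance Definition _ H K :=
  isBoundedOp.Build R H K (op0 H K) (@op0_bounded H K).

Section block_op.
Context (H1 H2 H3 : hilbertType R).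
Local Notation H := (H1 \oplus H2 \oplus H3).
Context
  (A11 : {bounded H1 -> H1}) (A12 : {bounded H2 -> H1}) (A13 : {bounded H3 -> H1})
  (A21 : {bounded H1 -> H2}) (A22 : {bounded H2 -> H2}) (A23 : {bounded H3 -> H2})
  (A31 : {bounded H1 -> H3}) (A32 : {bounded H2 -> H3}) (A33 : {bounded H3 -> H3}).

Definition block_op (x : H) : H :=
  let: (x1, x2, x3) := x in
  (A11 x1 + A12 x2 + A13 x3,
   A21 x1 + A22 x2 + A23 x3,
   A31 x1 + A32 x2 + A33 x3).

Let block_op_linear : linear block_op.
Proof.
have E (V W1 W2 W3 : lmodType R[i]) (f : {linear W1 -> V}) (g : {linear W2 -> V})
    (h : {linear W3 -> V}) a x1 x2 x3 y1 y2 y3 :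
    f (a *: x1 + y1) + g (a *: x2 + y2) + h (a *: x3 + y3) =
    a *: (f x1 + g x2 + h x3) + (f y1 + g y2 + h y3).
  by rewrite !linearP !scalerDr [RHS]addrACA [X in _ = X + _]addrACA.
move=> a [[x1 x2] x3] [[y1 y2] y3] /=.
by congr (_, _, _); exact: E.
Qed.

HB.instance Definition _ :=
  GRing.isLinear.Build R[i] H H *:%R block_op block_op_linear.

Let block_op_bounded :
  exists M : R[i], forall x : H, `|block_op x| <= M * `|x|.
Proof.
have E (K : hilbertType R) (f : {bounded H1 -> K}) (g : {bounded H2 -> K})
    (h : {bounded H3 -> K}) : exists M : R[i], forall x : H,
    `|f x.1.1 + g x.1.2 + h x.2| <= M * `|x|.
  have [a a0 fa] := bounded_op_ge0 f; have [b b0 gb] := bounded_op_ge0 g.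
  have [c c0 hc] := bounded_op_ge0 h; exists (a + b + c) => x.
  rewrite (le_trans (ler_normD _ _))// mulrDl lerD//; last first.
    by rewrite (le_trans (hc _))// ler_wpM2l// hsum_norm_snd.
  rewrite (le_trans (ler_normD _ _))// mulrDl lerD//.
    rewrite (le_trans (fa _))// ler_wpM2l//.
    exact: le_trans (hsum_norm_fst _) (hsum_norm_fst _).
  rewrite (le_trans (gb _))// ler_wpM2l//.
  exact: le_trans (hsum_norm_snd _) (hsum_norm_fst _).
have [a Ha] := E _ A11 A12 A13; have [b Hb] := E _ A21 A22 A23.
have [c Hc] := E _ A31 A32 A33; exists (a + b + c) => x.
have := lerD (lerD (Ha x) (Hb x)) (Hc x); rewrite -!mulrDl.
apply: le_trans; case: x => -[x1 x2] x3 /=.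
by rewrite (le_trans (hsum_norm_le _))//= lerD2r hsum_norm_le.
Qed.

HB.instance Definition _ := isBoundedOp.Build R H H block_op block_op_bounded.

End block_op.

(* [normc : R[i] -> R] brings the R[i]-valued norm back to R. The set below is
   nonempty and bounded, so [sup] is its least upper bound. *)
Definition opnorm H K (f : {bounded H -> K}) : R :=
  sup [set normc `|f x| | x in [set x : H | `|x| <= 1]].

Definition q_range H (q : R[i]) (T : {bounded H -> H}) : set R[i] :=
  [set z | exists x y : H,
    [/\ `|x| = 1, `|y| = 1, hdot x y = q & z = hdot (T x) y]].

(* [q_range q T] is bounded, and it is nonempty when `|q| <= 1 and H has
   dimension at least 2; [sup] of an empty set is 0. *)
Definition q_radius H (q : R[i]) (T : {bounded H -> H}) : R :=
  sup [set normc z | z in q_range q T].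

End bounded_op.

Arguments op0 {R} H K x.

(* Main.v *)
Require Import Defs.
From mathcomp Require Import all_boot all_order all_algebra.
From mathcomp Require Import all_classical all_reals all_analysis.
From mathcomp Require Import complex.
From mathcomp Require Import ring lra.

Set Implicit Arguments.
Unset Strict Implicit.
Unset Printing Implicit Defensive.

Import Order.TTheory GRing.Theory Num.Theory numFieldNormedType.Exports.
Import Normc.

Local Open Scope ring_scope.
Local Open Scope complex_scope.

(** The bound holds because [w_q(T) <= ||T|| <= m] with
    [m = max(||S1||, ||S2||)], and both constants on the right are at least 1.

    For unit vectors [x], [y] the Cauchy-Schwarz inequality
    ([hdot_cauchy_schwarz]) gives [|<T x, y>| <= ||T x||], hence
    [w_q(T) <= ||T||] ([q_radius_le]).  The block matrix [T] sends
    [(x1, x2, x3)] to [(S1 x2, S2 x3, 0)]: its two nonzero blocks act on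
    orthogonal summands and land in orthogonal summands, so
    [||T x||^2 = ||S1 x2||^2 + ||S2 x3||^2 <= m^2 ||x||^2]
    ([block_shift_norm_le]) with no loss from adding the two blocks.

    As for the constants, [sqrt 2 >= 1]; and for [0 <= p <= 1], squaring
    shows [p + sqrt (1 - p^2) >= 1], so that
    [(sqrt 2 + p + sqrt (1 - p^2)) / 2 >= 1]. *)

Section HilbertOperators.
Context {R : realType}.
Implicit Types H K : hilbertType R.

(** Inequalities between real quantities of the theorem are proved in [R[i]],
    where the norms live; this is the bridge. *)
Lemma normc_leE (z : R[i]) (M : R) : (normc z <= M) = (`|z| <= M%:C).
Proof. by rewrite -lecR. Qed.

Lemma normcK (z : R[i]) : 0 <= z -> (normc z)%:C = z.
Proof. by move=> z0; rewrite -[RHS]ger0_norm. Qed.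

(** The squared norm of the component of [x] orthogonal to [y] is
    [|x|^2 - |<x, y>|^2 / |y|^2], and it is nonnegative. *)
Lemma hdot_cauchy_schwarz H (x y : H) : `|hdot x y| <= `|x| * `|y|.
Proof.
have [->|y0] := eqVneq y 0; first by rewrite linear0r normr0 mulr_ge0.
have ny0 : `|y| != 0 by rewrite normr_eq0.
rewrite -(@ler_pXn2r _ 2) ?nnegrE ?mulr_ge0// exprMn.
rewrite [`|hdot x y| ^+ 2]normCK; set a := hdot x y; set c := a / `|y| ^+ 2.
have El z : hdot (x - c *: y) z = hdot x z - c * hdot y z.
  by rewrite linearBl /= linearZl_LR.
have Er z : hdot z (x - c *: y) = hdot z x - c^*%R * hdot z y.
  by rewrite linearBr /= linearZr_LR.
have cE : c^*%R = a^*%R / `|y| ^+ 2.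
  by rewrite rmorphM fmorphV rmorphXn /= (CrealP (normr_real y)).
have : 0 <= `|x - c *: y| ^+ 2 by rewrite exprn_ge0.
rewrite -hdot_norm El !Er !hdot_norm (hermC _ y) /= expr0 mul1r cE /c -/a.
have -> : `|x| ^+ 2 - a^*%R / `|y| ^+ 2 * a -
    a / `|y| ^+ 2 * (a^*%R - a^*%R / `|y| ^+ 2 * `|y| ^+ 2)
  = (`|x| ^+ 2 * `|y| ^+ 2 - a * a^*%R) / `|y| ^+ 2 by field.
by rewrite pmulr_lge0 ?subr_ge0// invr_gt0 exprn_gt0// normr_gt0.
Qed.

(** The supremum defining [opnorm] is over a bounded set, so it really is an
    upper bound; everything else about [opnorm] comes from this. *)
Lemma opnorm_ub_unit_ball H K (f : {bounded H -> K}) (x : H) :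
  `|x| <= 1 -> `|f x| <= (opnorm f)%:C.
Proof.
move=> x1; rewrite -[leLHS]normr_id -normc_leE; apply: ub_le_sup; last by exists x.
have [M M0 fM] := bounded_op_ge0 f; exists (normc M) => _ [y /= y1 <-].
by rewrite normc_leE normr_id normcK// (le_trans (fM y))// ler_piMr.
Qed.

Lemma opnorm_ub H K (f : {bounded H -> K}) (x : H) :
  `|f x| <= (opnorm f)%:C * `|x|.
Proof.
have [->|x0] := eqVneq x 0; first by rewrite linear0 !normr0 mulr0.
have nx0 : 0 < `|x| by rewrite normr_gt0.
rewrite -ler_pdivrMr//.
have -> : `|f x| / `|x| = `|f (`|x|^-1 *: x)|.
  by rewrite linearZ normrZ normfV normr_id mulrC.
by apply: opnorm_ub_unit_ball; rewrite normrZ normfV normr_id mulVf// gt_eqF.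
Qed.

Lemma opnorm_ge0 H K (f : {bounded H -> K}) : 0 <= opnorm f.
Proof.
have := @opnorm_ub_unit_ball _ _ f 0.
by rewrite linear0 !normr0 ler01 lecR; apply.
Qed.

(** By Cauchy-Schwarz, [|<T x, y>| <= |T x| |y| <= M] when [|x| = |y| = 1]. The
    hypothesis [0 <= M] is for an empty range, whose supremum is 0. *)
Lemma q_radius_le H (q : R[i]) (T : {bounded H -> H}) (M : R) :
  0 <= M -> (forall x, `|T x| <= M%:C * `|x|) -> q_radius q T <= M.
Proof.
move=> M0 TM; rewrite /q_radius; set E := (X in sup X).
have [->|/set0P E0] := eqVneq E set0; first by rewrite sup0.
apply: ge_sup => // _ [_ [x [y [x1 y1 _ ->]]] <-].
rewrite normc_leE (le_trans (hdot_cauchy_schwarz _ _))// y1 mulr1.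
by rewrite (le_trans (TM x))// x1 mulr1.
Qed.

End HilbertOperators.

(** Orthogonality of the summands makes the norm of the shift the maximum, not
    the sum, of the norms of its two blocks. *)
Lemma block_shift_norm_le (R : realType) (H1 H2 H3 : hilbertType R)
    (S1 : {bounded H2 -> H1}) (S2 : {bounded H3 -> H2})
    (x : H1 \oplus H2 \oplus H3) :
  `|block_op (op0 H1 H1) S1          (op0 H3 H1)
             (op0 H1 H2) (op0 H2 H2) S2
             (op0 H1 H3) (op0 H2 H3) (op0 H3 H3) x|
    <= (Num.max (opnorm S1) (opnorm S2))%:C * `|x|.
Proof.
set m := Num.max _ _.
have m0 : 0 <= m%:C by rewrite lecR le_max opnorm_ge0.
case: x => -[x1 x2] x3.
rewrite -(@ler_pXn2r _ 2) ?nnegrE ?mulr_ge0// exprMn !hsum_normE /=.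
rewrite /op0 !add0r !addr0 normr0 expr0n addr0.
have Sm (H K : hilbertType R) (S : {bounded H -> K}) (z : H) :
    opnorm S <= m -> `|S z| ^+ 2 <= m%:C ^+ 2 * `|z| ^+ 2.
  move=> Sm; rewrite -exprMn ler_pXn2r ?nnegrE ?mulr_ge0//.
  by rewrite (le_trans (opnorm_ub S z))// ler_wpM2r// lecR.
rewrite -addrA mulrDr ler_wpDl ?mulr_ge0 ?exprn_ge0// mulrDr.
by apply: lerD; apply: Sm; rewrite le_max lexx ?orbT.
Qed.

Theorem theorem3p3 (R : realType) (H1 H2 H3 : hilbertType R)
  (Hsep : separable (H1 \oplus H2 \oplus H3))
  (Hinf : infinite_dim (H1 \oplus H2 \oplus H3))
  (q : R[i]) (hq : `|q| <= 1)
  (S1 : {bounded H2 -> H1}) (S2 : {bounded H3 -> H2}) :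
  let T : {bounded H1 \oplus H2 \oplus H3 -> H1 \oplus H2 \oplus H3} :=
           block_op (op0 H1 H1) S1          (op0 H3 H1)
                    (op0 H1 H2) (op0 H2 H2) S2
                    (op0 H1 H3) (op0 H2 H3) (op0 H3 H3) in
  q_radius q T <=
    if normc q <= (Num.sqrt 2)^-1
    then Num.sqrt 2 * Num.max (opnorm S1) (opnorm S2)
    else (Num.sqrt 2 + normc q + Num.sqrt (1 - normc q ^+ 2)) / 2
         * Num.max (opnorm S1) (opnorm S2).
Proof.
(* The [let] sits under the coercion from bool to Prop. *)
cbv zeta.
have m0 : 0 <= Num.max (opnorm S1) (opnorm S2) by rewrite le_max opnorm_ge0.
apply: (le_trans (q_radius_le q m0 (block_shift_norm_le S1 S2))).
have s1 : 1 <= Num.sqrt (2 : R) by rewrite -[leLHS]sqrtr1 ler_sqrt// ler1n.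
case: ifP => _; rewrite ler_peMl//.
set p := normc q.
have p0 : 0 <= p by rewrite -lecR; exact: normr_ge0 q.
have p1 : p <= 1 by rewrite normc_leE.
have p2 : 0 <= 1 - p ^+ 2 by nra.
have t0 := sqrtr_ge0 (1 - p ^+ 2); have := sqr_sqrtr p2.
(* If p + t < 1 then p^2 + t^2 <= (p + t)^2 < 1, against p^2 + t^2 = 1. *)
by set s := Num.sqrt 2 in s1 *; set t := Num.sqrt _ in t0 *; nra.
Qed.
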